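(* Let $p$ be an odd prime and let $f(x)\in\mathbb{Q}[x]$ be an irreducible polynomial of degree $2$ having its roots in $\mathbb{R}$ and in $\mathbb{Q}_p$. Denote by $\alpha^{(r)},\overline{\alpha}^{(r)}$ its two roots in $\mathbb{R}$ and by $\alpha^{(p)}$ a root in $\mathbb{Q}_p$. Let $[a_0,a_1,\ldots]$ be the $p$-adic continued fraction of $\alpha^{(p)}$ produced by any one of the three algorithms Browkin I, Browkin II, or Algorithm (MR). If the sequence $(a_n)_{n\ge 0}$ is eventually periodic, then the continued fraction $[a_0,a_1,\ldots]$ converges in $\mathbb{R}$ (with respect to the Euclidean absolute value) to either $\alpha^{(r)}$ or $\overline{\alpha}^{(r)}$.
   Context: Let $p$ be an odd prime and $v_p$ the $p$-adic valuation. Every $\alpha\in\mathbb{Q}_p$ is written uniquely as $\alpha=\sum_{i=-r}^{+\infty}c_ip^i$ with $c_i\in\{-\frac{p-1}{2},\ldots,\frac{p-1}{2}\}$. Define $s,t:\mathbb{Q}_p\to\mathbb{Q}$ by $s(\alpha)=\sum_{i=-r}^{0}c_ip^i$ (with $s(\alpha)=0$ if $r<0$) and $t(\alpha)=\sum_{i=-r}^{-1}c_ip^i$ (with $t(\alpha)=0$ if $r\le 0$). Each algorithm, on input $\alpha\in\mathbb{Q}_p$, sets $\alpha_0=\alpha$ and, for $n\ge 0$, computes a rational number $a_n$ (partial quotient) from $\alpha_n$ and then sets $\alpha_{n+1}=\frac{1}{\alpha_n-a_n}$, stopping if $\alpha_n=a_n$. The choices of $a_n$ are as follows. Browkin I: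 $a_n=s(\alpha_n)$ for all $n$. Browkin II: $a_n=s(\alpha_n)$ if $n$ is even; $a_n=t(\alpha_n)$ if $n$ is odd and $v_p(\alpha_n-t(\alpha_n))=0$; $a_n=t(\alpha_n)-\mathrm{sign}(t(\alpha_n))$ if $n$ is odd and $v_p(\alpha_n-t(\alpha_n))\ne 0$, where $\mathrm{sign}$ is the usual sign of a rational number. Algorithm (MR): $a_n=s(\alpha_n)$ if $n$ is even and $a_n=t(\alpha_n)$ if $n$ is odd. The continued fraction is $[a_0,a_1,\ldots]=a_0+\cfrac{1}{a_1+\cfrac{1}{a_2+\ddots}}$; its $n$-th convergent is the rational number $\frac{A_n}{B_n}=[a_0,\ldots,a_n]$, where $A_0=a_0$, $A_1=a_1a_0+1$, $A_n=a_nA_{n-1}+A_{n-2}$ and $B_0=1$, $B_1=a_1$, $B_n=a_nB_{n-1}+B_{n-2}$ for $n\ge 2$. The continued fraction converges in $\mathbb{R}$ to $\xi$ if $A_n/B_n\to\xi$ in the Euclidean absolute value as $n\to\infty$. *)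

(* Defs.v *)
From HB Require Import structures.
From mathcomp Require Import all_boot all_order all_algebra ring zify.
From mathcomp Require Import boolp classical_sets reals ereal topology normedtype sequences.

Set Implicit Arguments.
Unset Strict Implicit.
Unset Printing Implicit Defensive.

Import Order.TTheory GRing.Theory Num.Theory.
Import numFieldNormedType.Exports.

Local Open Scope classical_set_scope.
Local Open Scope ring_scope.

(* The ring of p-adic integers is the inverse limit of the Z/p^n: an element is
   a sequence of residues f n in [0, p^n[ such that f n.+1 reduces to f n. The
   proof that p is prime is a parameter of the type, so that the integral domain
   structure, hence the field structure of padic, is inferred from the type.   *)
Section PadicInt.
Variables (p : nat) (p_pr : prime p).

Local Notation q n := ((p ^ n)%N : int).

Definition coherent (f : nat -> int) := forall n, f n = (f n.+1 %% q n)%Z.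

Record padic_int (pr : prime p) :=
  PadicInt { residue :> nat -> int; _ : `[< coherent residue >] }.

HB.instance Definition _ := [isSub for @residue p_pr].
HB.instance Definition _ := [Choice of padic_int p_pr by <:].

Local Notation Zp := (padic_int p_pr).

Lemma residueS (x : Zp) n : x n = (x n.+1 %% q n)%Z.
Proof. by case: x => f /= /asboolP. Qed.

Lemma residue_mod (x : Zp) n : (x n %% q n)%Z = x n.
Proof. by rewrite residueS modz_mod. Qed.

Lemma padic_intP (x y : Zp) : (forall n, x n = y n) -> x = y.
Proof. by move=> e; apply/val_inj/funext. Qed.

Lemma modz_dvdm (a d e : int) : (d %| e)%Z -> ((a %% e)%Z = a %[mod d])%Z.
Proof.
move=> /dvdzP[k ->]; rewrite [in RHS](divz_eq a (k * d)) mulrA.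
by rewrite modzMDl.
Qed.

Lemma modz_pS (a : int) n : ((a %% q n.+1)%Z = a %[mod q n])%Z.
Proof. by rewrite modz_dvdm // expnS PoszM dvdz_mull. Qed.

Lemma coherent_mod (g : nat -> int) :
  (forall n, g n.+1 = g n %[mod q n])%Z -> `[< coherent (fun n => g n %% q n)%Z >].
Proof. by move=> h; apply/asboolP => n; rewrite modz_pS h. Qed.

Definition of_residues g h : Zp := PadicInt p_pr (@coherent_mod g h).

Lemma padd_subproof (x y : Zp) n : (x n.+1 + y n.+1 = x n + y n %[mod q n])%Z.
Proof. by rewrite !(residueS _ n) modzDm. Qed.
Definition padd x y := of_residues (padd_subproof x y).

Lemma pmul_subproof (x y : Zp) n : (x n.+1 * y n.+1 = x n * y n %[mod q n])%Z.
Proof. by rewrite !(residueS _ n) modzMm. Qed.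
Definition pmul x y := of_residues (pmul_subproof x y).

Lemma popp_subproof (x : Zp) n : (- x n.+1 = - x n %[mod q n])%Z.
Proof. by rewrite !(residueS _ n) modzNm. Qed.
Definition popp x := of_residues (popp_subproof x).

Definition pconst (c : int) : Zp :=
  @of_residues (fun=> c) (fun n => erefl (c %% q n)%Z).

Lemma paddA : associative padd.
Proof. by move=> x y z; apply: padic_intP => n /=; rewrite modzDml modzDmr addrA. Qed.

Lemma paddC : commutative padd.
Proof. by move=> x y; apply: padic_intP => n /=; rewrite addrC. Qed.

Lemma padd0 : left_id (pconst 0) padd.
Proof. by move=> x; apply: padic_intP => n /=; rewrite modzDml add0r residue_mod. Qed.

Lemma paddN : left_inverse (pconst 0) popp padd.
Proof. by move=> x; apply: padic_intP => n /=; rewrite modzDml addNr. Qed.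

HB.instance Definition _ := GRing.isZmodule.Build Zp paddA paddC padd0 paddN.

Lemma pmulA : associative pmul.
Proof. by move=> x y z; apply: padic_intP => n /=; rewrite modzMml modzMmr mulrA. Qed.

Lemma pmulC : commutative pmul.
Proof. by move=> x y; apply: padic_intP => n /=; rewrite mulrC. Qed.

Lemma pmul1 : left_id (pconst 1) pmul.
Proof. by move=> x; apply: padic_intP => n /=; rewrite modzMml mul1r residue_mod. Qed.

Lemma pmulDl : left_distributive pmul padd.
Proof.
by move=> x y z; apply: padic_intP => n /=; rewrite modzMml modzDm mulrDl.
Qed.

Lemma pone_neq0 : pconst 1 != 0.
Proof.
apply/eqP => /(congr1 (fun x : Zp => x 1%N)) /=.
rewrite mod0z expn1 modz_small //= ltz_nat.
exact: prime_gt1.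
Qed.

HB.instance Definition _ :=
  GRing.Zmodule_isComNzRing.Build Zp pmulA pmulC pmul1 pmulDl pone_neq0.

Definition punit := [pred x : Zp | `[< exists y, y * x = 1 >] ].
Definition pinv (x : Zp) : Zp := if x \in punit then xget x [set y | y * x = 1] else x.

Lemma pmulV : {in punit, left_inverse 1 pinv *%R}.
Proof. by move=> x ux; rewrite /pinv ux; move: ux => /asboolP/(xgetPex x). Qed.

Lemma punitP (x y : Zp) : y * x = 1 -> x \in punit.
Proof. by move=> e; apply/asboolP; exists y. Qed.

Lemma pinv_out : {in [predC punit], pinv =1 id}.
Proof. by move=> x /negbTE nux; rewrite /pinv nux. Qed.

HB.instance Definition _ :=
  GRing.ComNzRing_hasMulInverse.Build Zp pmulV punitP pinv_out.

Lemma residue_le (x : Zp) m n : (m <= n)%N -> x m = (x n %% q m)%Z.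
Proof.
move=> /subnK <-; elim: (n - m)%N => [|i IH]; first by rewrite add0n residue_mod.
by rewrite IH addSn (residueS x (i + m)) modz_dvdm // expnD PoszM dvdz_mull.
Qed.

Lemma q_neq0 n : q n != 0.
Proof. by rewrite eqz_nat -lt0n expn_gt0 prime_gt0. Qed.

Lemma residue_dvd (x : Zp) m n : (m <= n)%N -> x m = 0 -> (q m %| x n)%Z.
Proof.
move=> /subnK <-; elim: (n - m)%N => [|k IH] xm0; first by rewrite add0n xm0.
have := IH xm0; rewrite (residueS x (k + m)) => /dvdz_mod0P.
rewrite modz_dvdm; first by move=> e; apply/dvdz_mod0P.
by rewrite expnD PoszM dvdz_mull.
Qed.

Lemma pintegral (x y : Zp) : x * y = 0 -> (x == 0) || (y == 0).
Proof.
move=> xy0; apply: contrapT => /negP; rewrite negb_or => /andP[x0 y0].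
have nz (z : Zp) : z != 0 -> exists n, z n != 0.
  move=> /eqP z0; apply: contrapT => nz; apply: z0; apply: padic_intP => n.
  rewrite /= mod0z; apply/eqP/negPn/negP => zn; apply: nz; by exists n.
have val (z : Zp) : z != 0 -> exists n, z n == 0 /\ z n.+1 != 0.
  move=> /nz ez; case: (ex_minnP ez) => [[|n]] zn nmin.
    by move: zn; rewrite residueS expn0 modz1 eqxx.
  exists n; split=> //; apply/negPn/negP => /nmin; by rewrite ltnn.
have [m [/eqP xm xm1]] := val _ x0; have [n [/eqP yn yn1]] := val _ y0.
pose N := (m + n).+1.
have /dvdzP[a xN] : (q m %| x N)%Z by apply: residue_dvd => //; rewrite /N -addnS leq_addr.
have /dvdzP[b yN] : (q n %| y N)%Z by apply: residue_dvd => //; rewrite /N -addSn leq_addl.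
have pa : ~~ (p %| a)%Z.
  apply: contra xm1 => /dvdzP[c ac].
  rewrite (@residue_le x m.+1 N) ?ltnS ?leq_addr // xN ac -mulrA -PoszM -expnS.
  by rewrite modzMl.
have pb : ~~ (p %| b)%Z.
  apply: contra yn1 => /dvdzP[c bc].
  rewrite (@residue_le y n.+1 N) ?ltnS ?leq_addl // yN bc -mulrA -PoszM -expnS.
  by rewrite modzMl.
have : (x * y) N = 0 by rewrite xy0 /= mod0z.
move=> /= /dvdz_mod0P; rewrite xN yN mulrACA -PoszM -expnD /N expnS PoszM.
rewrite dvdz_mul2r ?q_neq0 // => pab.
by move: pab pa pb; rewrite !dvdzE abszM Euclid_dvdM // => /orP[] ->.
Qed.

HB.instance Definition _ := GRing.ComUnitRing_isIntegral.Build Zp pintegral.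

Lemma residue_int (c : int) n : (c%:~R : Zp) n = (c %% q n)%Z.
Proof.
suff -> : c%:~R = pconst c by [].
elim/ssrint.int_rect: c => [|m IH|m IH]; first by rewrite mulr0z.
  rewrite -addn1 PoszD intrD IH; apply: padic_intP => k /=.
  by rewrite modzDm.
rewrite -addn1 PoszD opprD intrD IH; apply: padic_intP => k /=.
by rewrite modzDm -[LHS]modzDmr modzNm modzDmr.
Qed.

Lemma residue_nat (c n : nat) : (c%:R : Zp) n = (c %% q n)%Z.
Proof. exact: residue_int c n. Qed.

Lemma punit1 (x : Zp) : (x \is a GRing.unit) = (x 1%N != 0).
Proof.
apply/idP/idP => [ux|x1].
  apply: contraTneq ux => x1; apply/negP => /mulrV /(congr1 (fun z : Zp => z 1%N)).
  rewrite /= x1 mul0r mod0z expn1 modz_small //= ltz_nat.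
  exact: prime_gt1.
have co n : coprimez (x n) (q n).
  case: n => [|n]; first by rewrite coprimezE expn0 coprimen1.
  rewrite coprimezE coprimeXr // coprime_sym prime_coprime //.
  apply: contra x1 => px; rewrite (residue_le x (ltn0Sn n)) expn1.
  by apply/eqP/dvdz_mod0P; rewrite dvdzE.
pose g n := (egcdz (x n) (q n)).1.
have gP n : (g n * x n = 1 %[mod q n])%Z.
  rewrite /g; case: egcdzP => u v + _ /=; move: (co n) => /eqP -> e.
  by rewrite -e addrC modzMDl.
have gS n : (g n.+1 = g n %[mod q n])%Z.
  have h1 : (g n.+1 * x n = 1 %[mod q n])%Z.
    have dq : (q n %| q n.+1)%Z by rewrite expnS PoszM dvdz_mull.
    by rewrite (residueS x n) modzMmr -(modz_dvdm (g _ * _) dq) gP modz_dvdm.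
  transitivity ((g n.+1 * (g n * x n)) %% q n)%Z.
    by rewrite -modzMmr gP modzMmr mulr1.
  by rewrite mulrCA -modzMmr h1 modzMmr mulr1.
have : of_residues gS * x = 1.
  by apply: padic_intP => n /=; rewrite modzMml gP.
by move=> /punitP.
Qed.

Lemma pdivX (x : Zp) m : x m = 0 -> exists y : Zp, x = p%:R ^+ m * y.
Proof.
move=> xm0; pose g n := (x (n + m)%N %/ q m)%Z.
have gK n : g n * q m = x (n + m)%N by rewrite divzK // residue_dvd // leq_addl.
have gS n : (g n.+1 = g n %[mod q n])%Z.
  apply/eqP; rewrite eqz_mod_dvd -(@dvdz_mul2r (q m)) ?q_neq0 //.
  rewrite mulrBl !gK -PoszM -expnD -eqz_mod_dvd addSn.
  by rewrite (residueS x (n + m)) modz_mod.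
exists (of_residues gS); apply: padic_intP => n.
rewrite -natrX [RHS]/= residue_nat modzMml modzMmr mulrC gK.
by rewrite [LHS](residue_le x (leq_addr m n)).
Qed.

Lemma pnat_neq0 n : (p%:R ^+ n : Zp) != 0.
Proof.
apply/eqP => /(congr1 (fun z : Zp => z n.+1)); rewrite /= mod0z -natrX.
rewrite residue_nat modz_small //; first by move/eqP; rewrite (negbTE (q_neq0 n)).
by rewrite lez_nat leq0n ltz_nat /= ltn_exp2l ?ltnSn // prime_gt1.
Qed.

Lemma padic_int_decomp (x : Zp) : x != 0 ->
  exists m, exists2 u : Zp, u \is a GRing.unit & x = p%:R ^+ m * u.
Proof.
move=> /eqP x0.
have ez : exists n, x n != 0.
  apply: contrapT => nz; apply: x0; apply: padic_intP => n.
  rewrite /= mod0z; apply/eqP/negPn/negP => zn; apply: nz; by exists n.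
case: (ex_minnP ez) => [[|n]] xn nmin.
  by move: xn; rewrite residueS expn0 modz1 eqxx.
have xn0 : x n = 0 by apply/eqP/negPn/negP => /nmin; rewrite ltnn.
have [y xE] := pdivX xn0; exists n, y => //.
rewrite punit1; apply: contra xn => /eqP /pdivX[z yE].
rewrite xE yE mulrA -exprSr -natrX /= residue_nat modzMml.
by rewrite modzMr.
Qed.

End PadicInt.

Definition padic (p : nat) (p_pr : prime p) := {fraction (padic_int p_pr)}.

Section Padic.
Variables (p : nat) (p_pr : prime p).

Local Notation Zp := (padic_int p_pr).
Local Notation Qp := (padic p_pr).
Local Notation "x %:F" := (@FracField.tofrac Zp x).

(* v_p(x) is the k such that x = p^k u with u a p-adic unit; v_p(0) = +oo. *)
Definition padic_val (x : Qp) : \bar int :=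
  if x == 0 then +oo%E else
  (xget 0 [set k : int | exists2 u : Zp, u \is a GRing.unit
                       & x = p%:R ^ k * u%:F])%:E.

Local Notation pi := (p%:R : Qp).

Lemma pi_neq0 : pi != 0.
Proof.
rewrite -(rmorph_nat (@FracField.tofrac Zp)) tofrac_eq0.
exact: pnat_neq0 1%N.
Qed.

Lemma tofracp n : (p%:R ^+ n : Zp)%:F = pi ^ n%:Z.
Proof. by rewrite rmorphXn rmorph_nat. Qed.

Lemma padic_decomp (x : Qp) : x != 0 ->
  exists k : int, exists2 u : Zp, u \is a GRing.unit & x = pi ^ k * u%:F.
Proof.
rewrite -[x]reprK; move: (repr x) => r.
rewrite -(Ratio_numden r).
have d0 := denom_ratioP r.
have -> : \pi_({fraction Zp})%qT (Ratio (\n_r) (\d_r)) = (\n_r)%:F / (\d_r)%:F :> Qp.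
  apply/(mulIf (x := (\d_r)%:F)); first by rewrite tofrac_eq0.
  rewrite divfK ?tofrac_eq0 //; unlock FracField.tofrac; rewrite -[LHS]FracField.pi_mul /FracField.mulf.
  rewrite !numden_Ratio ?oner_eq0 // mulr1.
  apply/eqmodP; rewrite /= FracField.equivfE !numden_Ratio ?oner_eq0 //.
  by rewrite mulr1 mulrC.
rewrite mulf_eq0 invr_eq0 !tofrac_eq0 (negbTE d0) orbF => n0.
have [m [u uu ->]] := padic_int_decomp n0.
have [n [v uv ->]] := padic_int_decomp d0.
exists (m%:Z - n%:Z); exists (u / v); first by rewrite unitrM uu unitrV uv.
rewrite !rmorphM /= !tofracp rmorphV //= invfM expfzDr ?pi_neq0 // -invr_expz.
by rewrite mulrACA.
Qed.

Lemma padic_decomp_unique (k l : int) (u v : Zp) :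
  u \is a GRing.unit -> v \is a GRing.unit ->
  pi ^ k * u%:F = pi ^ l * v%:F -> k = l.
Proof.
wlog: k l u v / k < l => [h uu uv e|].
  have [kl|lk|//] := ltgtP k l; first exact: (h _ _ u v).
  by apply/esym/(h _ _ v u).
move=> kl uu uv e; suff : false by [].
have [n lE] : exists n : nat, l = k + n.+1%:Z by exists (`|l - k|.-1)%N; lia.
move: e; rewrite lE expfzDr ?pi_neq0 // -mulrA.
move=> /(mulfI (expfz_neq0 _ pi_neq0)); rewrite -tofracp -rmorphM => /eqP.
rewrite tofrac_eq => /eqP uE; move: uu; rewrite punit1 uE exprS -mulrA /=.
by rewrite residue_nat expn1 modzz mul0r mod0z.
Qed.

Lemma padic_val_unit (k : int) (u : Zp) : u \is a GRing.unit ->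
  padic_val (pi ^ k * u%:F) = k%:E.
Proof.
move=> uu; rewrite /padic_val mulf_eq0 (negbTE (expfz_neq0 _ pi_neq0)) tofrac_eq0 /=.
rewrite (negbTE (memPn _ u uu)) ?unitr0 //; congr _%:E; case: xgetP => [l _ [v uv e]|].
  exact/esym/(padic_decomp_unique uu uv e).
by move=> /(_ k)[]; exists u.
Qed.

Lemma padic_val_geP (N : int) (x : Qp) :
  (N%:E <= padic_val x)%E <-> exists z : Zp, x = pi ^ N * z%:F.
Proof.
split=> [|[z ->]].
  have [->|x0] := eqVneq x 0; first by exists 0; rewrite rmorph0 mulr0.
  have [k [u uu xE]] := padic_decomp x0; rewrite xE padic_val_unit // lee_fin => Nk.
  exists (p%:R ^+ `|k - N| * u); rewrite rmorphM /= tofracp mulrA -expfzDr ?pi_neq0 //.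
  by congr (_ ^ _ * _); lia.
have [->|z0] := eqVneq z 0; first by rewrite rmorph0 mulr0 /padic_val eqxx leey.
have [m [u uu ->]] := padic_int_decomp z0.
rewrite rmorphM /= tofracp mulrA -expfzDr ?pi_neq0 // padic_val_unit // lee_fin.
by rewrite lerDl.
Qed.

Definition padic_cvg (x : nat -> Qp) (l : Qp) : Prop :=
  forall N : int, \forall n \near \oo, (N%:E <= padic_val (l - x n)%R)%E.

(* c_(-r) p^(-r) + ... + c_(m-r-1) p^(m-r-1) *)
Definition digit_sum (F : fieldType) (r : nat) (c : int -> int) (m : nat) : F :=
  \sum_(j < m) (c (j%:Z - r%:Z))%:~R * p%:R ^ (j%:Z - r%:Z).

(* Leading digits may vanish, so that r can be taken nonnegative: v_p(alpha) >= 0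
   is covered by r = 0, and then the sums for s and t are c_0 and 0.          *)
Definition padic_expansion (alpha : Qp) (r : nat) (c : int -> int) : Prop :=
  [/\ forall i, (`|c i| <= p.-1./2)%N,
      forall i, i < - r%:Z -> c i = 0
    & padic_cvg (digit_sum Qp r c) alpha].

(* The value does not depend on the choice of r and c, and an expansion exists
   when p is odd: see padic_expansion_exists and browkin_{s,t}_expansion.     *)
Definition browkin_s (alpha : Qp) : rat :=
  xget 0 [set x | exists r c, padic_expansion alpha r c /\ x = digit_sum rat r c r.+1].

Definition browkin_t (alpha : Qp) : rat :=
  xget 0 [set x | exists r c, padic_expansion alpha r c /\ x = digit_sum rat r c r].

Lemma digit_sum_widen (F : fieldType) r k c m : (forall i : int, i < - r%:Z -> c i = 0) ->
  digit_sum F (k + r) c (k + m) = digit_sum F r c m.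
Proof.
move=> c0; rewrite /digit_sum big_split_ord /= big1 ?add0r => [|j _].
  apply: eq_bigr => j _.
  by have -> : (k + j)%N%:Z - (k + r)%N%:Z = j%:Z - r%:Z by lia.
by rewrite c0 ?mul0r //; have := ltn_ord j; lia.
Qed.

Lemma digit_sum_split r c m k : exists y : Zp,
  digit_sum Qp r c (m + k) = digit_sum Qp r c m + pi ^ (m%:Z - r%:Z) * y%:F.
Proof.
exists (\sum_(j < k) (c ((m + j)%N%:Z - r%:Z))%:~R * p%:R ^+ j).
rewrite /digit_sum big_split_ord /=; congr (_ + _).
rewrite rmorph_sum mulr_sumr; apply: eq_bigr => j _.
rewrite rmorphM /= rmorph_int tofracp mulrCA -expfzDr ?pi_neq0 //.
by congr (_ * _ ^ _); lia.
Qed.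

Lemma balanced_digit (a : int) : odd p ->
  exists c : int, (`|c| <= p.-1./2)%N /\ (p %| a - c)%Z.
Proof.
move=> po; have p_gt0 := prime_gt0 p_pr.
have r0 : (0 <= a %% p)%Z by rewrite modz_ge0 // eqz_nat -lt0n.
have rp : (a %% p < p)%Z by rewrite ltz_pmod.
have aE := divz_eq a p.
move: aE r0 rp; set r := (a %% p)%Z; set k := (a %/ p)%Z => aE r0 rp.
have [h|h] := leqP `|r|%N p.-1./2.
  by exists r; split=> //; rewrite aE addrK dvdz_mull.
exists (r - p%:Z); split; first lia.
have -> : a - (r - p%:Z) = (k + 1) * p%:Z by rewrite aE; ring.
by rewrite dvdz_mull.
Qed.

Lemma padic_int_digit (z : Zp) : odd p -> exists dy : int * Zp,
  (`|dy.1| <= p.-1./2)%N /\ z = dy.1%:~R + p%:R * dy.2.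
Proof.
move=> po; have [c [cle cz]] := balanced_digit (z 1%N) po.
have /pdivX[y zE] : (z - c%:~R) 1%N = 0.
  have -> : z - c%:~R = z + (- c)%:~R by rewrite mulrNz.
  rewrite /= residue_int modzDmr expn1; exact/dvdz_mod0P.
by exists (c, y); split=> //=; rewrite -[p%:R]expr1 -zE addrC subrK.
Qed.

Lemma padic_expansion_exists (alpha : Qp) : odd p ->
  exists r c, padic_expansion alpha r c.
Proof.
move=> po.
have [r [z ->]] : exists r : nat, exists z : Zp, alpha = pi ^ (- r%:Z) * z%:F.
  have [->|a0] := eqVneq alpha 0; first by exists 0%N, 0; rewrite rmorph0 mulr0.
  have [k [u _ ->]] := padic_decomp a0.
  exists (absz k), (p%:R ^+ absz (k + (absz k)%:Z)%R * u).
  rewrite rmorphM /= tofracp mulrA -expfzDr ?pi_neq0 //.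
  by congr (_ ^ _ * _); lia.
have /choice[st stP] := fun z => padic_int_digit z po.
pose zs n := iter n (fun z => (st z).2) z.
pose c (i : int) : int := if i < - r%:Z then 0 else (st (zs (absz (i + r%:Z)%R))).1.
exists r, c; split=> [i|i ir|]; rewrite /c.
- by case: ifP => // _; case: (stP (zs (absz (i + r%:Z)%R))).
- by rewrite ir.
have sumE n : pi ^ (- r%:Z) * z%:F = digit_sum Qp r c n + pi ^ (n%:Z - r%:Z) * (zs n)%:F.
  elim: n => [|n IH]; first by rewrite /digit_sum big_ord0 !add0r.
  rewrite IH {1}(stP (zs n)).2 {2}/digit_sum big_ord_recr /= -addrA; congr (_ + _).
  rewrite rmorphD rmorphM /= rmorph_int rmorph_nat mulrDr; congr (_ + _).
    rewrite mulrC /c ifF; last by lia.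
    by have -> : absz (n%:Z - r%:Z + r%:Z)%R = n by lia.
  rewrite mulrA -[X in _ * X * _]expr1z -expfzDr ?pi_neq0 //.
  by congr (_ ^ _ * _); lia.
move=> N; exists (absz (N + r%:Z)%R) => // n /= hn.
rewrite [in X in X - _](sumE n) addrAC subrr add0r.
apply/padic_val_geP; exists (p%:R ^+ absz (n%:Z - r%:Z - N)%R * zs n).
rewrite rmorphM /= tofracp mulrA -expfzDr ?pi_neq0 //.
by congr (_ ^ _ * _); lia.
Qed.

Lemma padic_expansion_unique (alpha : Qp) r r' c c' : odd p ->
  padic_expansion alpha r c -> padic_expansion alpha r' c' -> c =1 c'.
Proof.
move=> po [cle c0 ccv] [cle' c0' ccv'].
pose R := (r' + r)%N.
suff h : forall m : nat, c (m%:Z - R%:Z) = c' (m%:Z - R%:Z).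
  move=> i; have [iR|iR] := ltP i (- R%:Z).
    have [i1 i2] : i < - r%:Z /\ i < - r'%:Z by rewrite /R in iR; lia.
    by rewrite c0 ?c0'.
  have := h (absz (i + R%:Z)%R).
  by have -> : (absz (i + R%:Z)%R)%:Z - R%:Z = i by lia.
elim/ltn_ind => m IH; pose i := m%:Z - R%:Z; rewrite -/i.
have [n0 _ h0] := ccv (i + 1); have [n1 _ h1] := ccv' (i + 1).
pose k := (n0 + n1 + r + r')%N; pose M := (m.+1 + (n0 + n1))%N.
have MrE : (m.+1 + k = r' + (M + r))%N by rewrite /M /k; lia.
have MrE' : (m.+1 + k = r + (M + r'))%N by rewrite /M /k; lia.
have n0M : (n0 <= M + r)%N by rewrite /M; lia.
have n1M : (n1 <= M + r')%N by rewrite /M; lia.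
have /padic_val_geP[z0] := h0 _ n0M; have /padic_val_geP[z1] := h1 _ n1M.
rewrite -(digit_sum_widen _ r _ c0') -MrE' -(digit_sum_widen _ r' _ c0) -MrE.
rewrite -/R (addnC r r') -/R.
have [y0 ->] := digit_sum_split R c m.+1 k.
have [y1 ->] := digit_sum_split R c' m.+1 k.
have SE : digit_sum Qp R c m = digit_sum Qp R c' m.
  by apply: eq_bigr => j _; rewrite IH.
have recE d : digit_sum Qp R d m.+1 = digit_sum Qp R d m + (d i)%:~R * pi ^ i.
  by rewrite /digit_sum big_ord_recr.
rewrite !recE SE.
have -> : m.+1%:Z - R%:Z = i + 1 by rewrite /i; lia.
clearbody i. rewrite expfzDr ?pi_neq0 // expr1z => e1 e0.
have : pi ^ i * (c i - c' i)%:~R = pi ^ i * (pi * (z1 + y1 - z0 - y0)%:F).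
  rewrite intrB !rmorphB rmorphD /=.
  transitivity (pi ^ i * pi * z1%:F + pi ^ i * pi * y1%:F - pi ^ i * pi * z0%:F - pi ^ i * pi * y0%:F).
    by rewrite -e0 -e1; ring.
  by ring.
move=> /(mulfI (expfz_neq0 _ pi_neq0)) /eqP.
rewrite -(rmorph_int (@FracField.tofrac Zp)) -(rmorph_nat (@FracField.tofrac Zp)) -rmorphM.
rewrite tofrac_eq => /eqP /(congr1 (fun z : Zp => z 1%N)).
rewrite residue_int /= residue_nat expn1 modzz mul0r mod0z => /dvdz_mod0P.
move: (cle i) (cle' i) => ci ci' /dvdzP[w wE].
have p_gt0 := prime_gt0 p_pr.
have : w = 0 by nia.
lia.
Qed.

Lemma browkin_s_expansion (alpha : Qp) r c : odd p -> padic_expansion alpha r c ->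
  browkin_s alpha = digit_sum rat r c r.+1.
Proof.
move=> po ex; rewrite /browkin_s; case: xgetP => [_ -> [r' [c' [ex' ->]]]|]; last first.
  by move=> /(_ (digit_sum rat r c r.+1))[]; exists r, c.
have cc : c = c' by apply/funext/(padic_expansion_unique po ex ex').
case: ex ex' => _ c0 _ [_ c0' _]; rewrite cc in c0 *.
rewrite -(digit_sum_widen _ r _ c0') -(digit_sum_widen _ r' _ c0).
by rewrite addnC !addnS addnC.
Qed.

Lemma browkin_t_expansion (alpha : Qp) r c : odd p -> padic_expansion alpha r c ->
  browkin_t alpha = digit_sum rat r c r.
Proof.
move=> po ex; rewrite /browkin_t; case: xgetP => [_ -> [r' [c' [ex' ->]]]|]; last first.
  by move=> /(_ (digit_sum rat r c r))[]; exists r, c.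
have cc : c = c' by apply/funext/(padic_expansion_unique po ex ex').
case: ex ex' => _ c0 _ [_ c0' _]; rewrite cc in c0 *.
rewrite -(digit_sum_widen _ r _ c0') -(digit_sum_widen _ r' _ c0).
by rewrite addnC.
Qed.

End Padic.

Variant algorithm := BrowkinI | BrowkinII | MR.

Section ContinuedFraction.
Variables (p : nat) (p_pr : prime p).
Local Notation Qp := (padic p_pr).

Definition partial_quotient (alg : algorithm) (n : nat) (x : Qp) : rat :=
  match alg with
  | BrowkinI => browkin_s x
  | BrowkinII =>
      if ~~ odd n then browkin_s x
      else if padic_val (x - ratr (browkin_t x)) == 0%:E then browkin_t x
      else browkin_t x - Num.sg (browkin_t x)
  | MR => if ~~ odd n then browkin_s x else browkin_t x
  end.

(* alpha_n, or None if the algorithm has stopped before step n *)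
Fixpoint complete_quotient (alg : algorithm) (alpha : Qp) (n : nat) : option Qp :=
  if n is m.+1 then
    if complete_quotient alg alpha m is Some x then
      let a := ratr (partial_quotient alg m x) in
      if x == a then None else Some (x - a)^-1
    else None
  else Some alpha.

Definition is_padic_cf (alg : algorithm) (alpha : Qp) (a : nat -> rat) : Prop :=
  forall n, omap (partial_quotient alg n) (complete_quotient alg alpha n) = Some (a n).

End ContinuedFraction.

Definition eventually_periodic (T : Type) (a : nat -> T) : Prop :=
  exists N k, (0 < k)%N /\ forall n, (N <= n)%N -> a (n + k)%N = a n.

Fixpoint cf_num (a : nat -> rat) (n : nat) : rat :=
  match n with
  | 0 => a 0%N
  | n1.+1 =>
      match n1 with
      | 0 => a 1%N * a 0%N + 1
      | n2.+1 => a n * cf_num a n1 + cf_num a n2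
      end
  end.

Fixpoint cf_den (a : nat -> rat) (n : nat) : rat :=
  match n with
  | 0 => 1
  | n1.+1 =>
      match n1 with
      | 0 => a 1%N
      | n2.+1 => a n * cf_den a n1 + cf_den a n2
      end
  end.

Definition convergent (a : nat -> rat) (n : nat) : rat := cf_num a n / cf_den a n.

Definition real_cf_cvg (R : realType) (a : nat -> rat) (xi : R) : Prop :=
  (fun n => ratr (convergent a n) : R) @ \oo --> xi.

(* Main.v *)
(** Let [u_n = A_n - alpha B_n].  In [Q_p] it satisfies [u_(n+1) = - d_(n+1) u_n],
where [d_n = alpha_n - a_n] is a p-adic integer, divisible by [p] for even [n].  A
sequence of partial quotients therefore determines the complete quotients, so
these are eventually periodic too, [u_(n+k) = lambda u_n] for large [n], and
[lambda] is divisible by [p].  Now [lambda] lies in [Q(alpha)], so its two real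
conjugates are the factors by which the real errors [A_n - xi B_n] and
[A_n - xi' B_n] are multiplied over a period.  Taking [k] even, the determinant
identity shows that their product is 1, and neither is [1] or [-1], because then
[lambda] would be a p-adic unit.  Hence one of them is less than 1 in absolute
value and the other greater, the quotient of the two errors tends to 0 or to
infinity, and [A_n / B_n] tends to [xi] or to [xi']. *)
From HB Require Import structures.
Require Import Defs.
From mathcomp Require Import all_boot all_order all_algebra ring zify qpoly.
From mathcomp Require Import boolp classical_sets reals ereal topology normedtype sequences.

Set Implicit Arguments.
Unset Strict Implicit.
Unset Printing Implicit Defensive.

Import Order.TTheory GRing.Theory Num.Theory.
Local Open Scope ring_scope.

(** * The embedding of Q into Q_p, and divisibility by powers of p *)

Section PadicIntegral.
Variables (p : nat) (p_pr : prime p).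
Local Notation Zp := (padic_int p_pr).
Local Notation Qp := (padic p_pr).
Local Notation "x %:F" := (@FracField.tofrac Zp x).
Local Notation pi := (p%:R : Qp).

(** A nonzero [c] is smaller in absolute value than p^|c|, so its residue at level |c| is
    nonzero. *)
Lemma padic_intr_eq0 (c : int) : ((c%:~R : Qp) == 0) = (c == 0).
Proof.
apply/eqP/eqP => [|->]; last by rewrite mulr0z.
rewrite -(rmorph_int (@FracField.tofrac Zp)) => /eqP.
rewrite tofrac_eq0 => /eqP c0.
have := residue_int p_pr c `|c|; rewrite c0 /= mod0z => /esym/dvdz_mod0P.
rewrite dvdzE /= => h; apply/eqP; rewrite -absz_eq0 -leqn0 leqNgt.
by apply/negP => /dvdn_leq /(_ h); rewrite leqNgt ltn_expl // prime_gt1.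
Qed.

(* The library makes ratr a ring morphism only into a numFieldType. *)
Definition padic_ratr : rat -> Qp := ratr.

Let den_neq0 (x : rat) : ((denq x)%:~R : Qp) != 0.
Proof. by rewrite padic_intr_eq0 denq_neq0. Qed.

Let rat_den (x : rat) : x * (denq x)%:~R = (numq x)%:~R.
Proof. by rewrite -{1}[x]divq_num_den divfK // intr_eq0 denq_neq0. Qed.

(** Allowing fractions that are not reduced lets sums and products be checked on the product of the
    denominators. *)
Lemma padic_ratrE (x : rat) (m n : int) :
  n != 0 -> x * n%:~R = m%:~R -> padic_ratr x * n%:~R = m%:~R.
Proof.
move=> n0 xE; have d0 : ((denq x)%:~R : rat) != 0 by rewrite intr_eq0 denq_neq0.
have e : numq x * n = m * denq x.
  by apply/eqP; rewrite -(eqr_int rat) !intrM -xE -rat_den mulrAC.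
apply: (mulIf (den_neq0 x)); rewrite /padic_ratr /ratr mulrAC divfK //.
by rewrite -!intrM e.
Qed.

Let padic_ratr_den (x : rat) : padic_ratr x * (denq x)%:~R = (numq x)%:~R.
Proof. by rewrite /padic_ratr /ratr divfK. Qed.

Lemma padic_ratr_is_zmod_morphism : zmod_morphism padic_ratr.
Proof.
move=> x y; apply: (mulIf (mulf_neq0 (den_neq0 x) (den_neq0 y))).
rewrite -intrM (@padic_ratrE _ (numq x * denq y - numq y * denq x)).
- rewrite intrB !intrM -!padic_ratr_den; ring.
- by rewrite mulf_neq0 ?denq_neq0.
- rewrite intrB !intrM -!rat_den; ring.
Qed.

Lemma padic_ratr_is_monoid_morphism : monoid_morphism padic_ratr.
Proof.
split=> [|x y]; first by rewrite /padic_ratr /ratr divr1.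
apply: (mulIf (mulf_neq0 (den_neq0 x) (den_neq0 y))).
rewrite -intrM (@padic_ratrE _ (numq x * numq y)).
- rewrite !intrM -!padic_ratr_den; ring.
- by rewrite mulf_neq0 ?denq_neq0.
- rewrite !intrM -!rat_den; ring.
Qed.

HB.instance Definition _ :=
  GRing.isZmodMorphism.Build rat Qp padic_ratr padic_ratr_is_zmod_morphism.
HB.instance Definition _ :=
  GRing.isMonoidMorphism.Build rat Qp padic_ratr padic_ratr_is_monoid_morphism.

Lemma padic_ratr_digit_sum r c m :
  padic_ratr (digit_sum p rat r c m) = digit_sum p Qp r c m.
Proof.
rewrite /digit_sum rmorph_sum; apply: eq_bigr => j _.
by rewrite rmorphM /= rmorph_int fmorphXz /= rmorph_nat.
Qed.

Definition pmultiple (m : nat) (x : Qp) := exists z : Zp, x = (p%:R ^+ m * z)%:F.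

Lemma pmultipleD m x y : pmultiple m x -> pmultiple m y -> pmultiple m (x + y).
Proof. by move=> [u ->] [v ->]; exists (u + v); rewrite mulrDr rmorphD. Qed.

Lemma pmultipleN m x : pmultiple m x -> pmultiple m (- x).
Proof. by move=> [u ->]; exists (- u); rewrite mulrN rmorphN. Qed.

Lemma pmultipleM m n x y :
  pmultiple m x -> pmultiple n y -> pmultiple (m + n) (x * y).
Proof.
by move=> [u ->] [v ->]; exists (u * v); rewrite -rmorphM /= exprD mulrACA.
Qed.

Lemma pmultiple_le m n x : (m <= n)%N -> pmultiple n x -> pmultiple m x.
Proof.
move=> /subnKC <- [u ->]; exists (p%:R ^+ (n - m) * u).
by rewrite exprD mulrA.
Qed.

Lemma pmultiple_int (c : int) : pmultiple 0 c%:~R.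
Proof. by exists c%:~R; rewrite mul1r rmorph_int. Qed.

Lemma pmultiple_eq0 x : (forall m, pmultiple m x) -> x = 0.
Proof.
move=> h; have [//|x0] := eqVneq x 0.
have [k [u uu xE]] := padic_decomp x0; have [z zE] := h `|k|.+1.
have : ((`|k|.+1%:Z)%:E <= padic_val x)%E.
  by apply/padic_val_geP; exists z; rewrite zE rmorphM /= tofracp.
by rewrite xE padic_val_unit // lee_fin; lia.
Qed.

Lemma pmultiple1 (e : Qp) : e = 1 \/ e = -1 -> ~ pmultiple 1 e.
Proof.
(* Squaring treats both signs at once: 1 itself would be a multiple of p. *)
move=> e1 /[dup] h /pmultipleM-/(_ _ _ h).
have -> : e * e = 1 by case: e1 => ->; rewrite ?mulr1 ?mulrNN ?mulr1.
move=> [z] /eqP; rewrite -(rmorph1 (@FracField.tofrac Zp)) tofrac_eq => /eqP.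
rewrite exprS -mulrA => /(congr1 (fun z : Zp => z 1%N)) /=.
rewrite residue_nat expn1 modzz mul0r mod0z modz_small //.
by rewrite ltz_nat /= prime_gt1.
Qed.

(** * Remainders and complete quotients of the three algorithms *)

Lemma padic_expansion_remainder (x : Qp) r c m : padic_expansion x r c ->
  exists z : Zp, x - digit_sum p Qp r c m = pi ^ (m%:Z - r%:Z) * z%:F.
Proof.
move=> [_ _ /(_ (m%:Z - r%:Z)) [n _ /(_ (m + n)%N (leq_addl m n)) /=]].
(* The partial sum of m + n terms is p^(m-r)-close to [x], and the digits it adds are multiples of
   p^(m-r). *)
move=> /padic_val_geP[z]; have [y ->] := digit_sum_split p_pr r c m n => zE.
exists (z + y); rewrite rmorphD mulrDr -zE; ring.
Qed.

Lemma browkin_s_remainder (x : Qp) : odd p ->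
  pmultiple 1 (x - ratr (browkin_s x)).
Proof.
move=> po; have [r [c xE]] := padic_expansion_exists x po.
rewrite (browkin_s_expansion po xE) -/(padic_ratr _) padic_ratr_digit_sum.
(* The first r.+1 digits end at p^0, so the remainder starts at p^1. *)
have [z ->] := padic_expansion_remainder r.+1 xE; exists z.
by rewrite rmorphM /= tofracp; congr (_ ^ _ * _); lia.
Qed.

Lemma browkin_t_remainder (x : Qp) : odd p ->
  pmultiple 0 (x - ratr (browkin_t x)).
Proof.
move=> po; have [r [c xE]] := padic_expansion_exists x po.
rewrite (browkin_t_expansion po xE) -/(padic_ratr _) padic_ratr_digit_sum.
have [z ->] := padic_expansion_remainder r xE; exists z.
by rewrite rmorphM /= tofracp; congr (_ ^ _ * _); lia.
Qed.

(** At even [n] all three algorithms use s, which leaves a multiple of p. At odd [n] integrality is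
    enough, and the sign correction of Browkin II, being an integer, preserves it. *)
Lemma partial_quotient_remainder alg n (x : Qp) : odd p ->
  pmultiple (~~ odd n) (x - ratr (partial_quotient alg n x)).
Proof.
move=> po; have s1 := browkin_s_remainder x po; have t0 := browkin_t_remainder x po.
have s0 := pmultiple_le (leq0n 1) s1.
case: alg => /=; case: (odd n) => //=; case: ifP => // _.
rewrite -/(padic_ratr _) rmorphB /= opprB addrCA addrC; apply: pmultipleD => //.
have -> : Num.sg (browkin_t x) = (sgz (browkin_t x))%:~R by rewrite sgrEz.
by rewrite rmorph_int; apply: pmultiple_int.
Qed.

(** [is_padic_cf] provides a partial quotient at every step, so the algorithm never stops and the
    complete quotients form a total sequence. *)
Lemma complete_quotients alg (alpha : Qp) a : odd p -> is_padic_cf alg alpha a ->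
  exists x : nat -> Qp, [/\ x 0%N = alpha,
    forall n, x n.+1 * (x n - padic_ratr (a n)) = 1
    & forall n, pmultiple (~~ odd n) (x n - padic_ratr (a n))].
Proof.
move=> po acf.
have /choice[x xE] n : exists x, complete_quotient alg alpha n = Some x.
  by have := acf n; case: complete_quotient => // x _; exists x.
have aE n : a n = partial_quotient alg n (x n).
  by have := acf n; rewrite xE => -[].
exists x; split=> [|n|n]; last by rewrite aE; apply: partial_quotient_remainder.
  by have := xE 0%N => -[].
have := xE n.+1; rewrite /= xE -aE; case: eqP => // ne [<-].
by rewrite mulVf // subr_eq0; apply/eqP.
Qed.

(* If x n = a_n + d_n and y n = a_n + e_n then x n - y n = d_n e_n (y n.+1 - x n.+1),
   and d_n e_n is divisible by p ^ 2 for every even n. *)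
Lemma complete_quotient_unique (x y : nat -> Qp) (b : nat -> Qp) :
  (forall n, x n.+1 * (x n - b n) = 1) -> (forall n, y n.+1 * (y n - b n) = 1) ->
  (forall n, pmultiple (~~ odd n) (x n - b n)) ->
  (forall n, pmultiple (~~ odd n) (y n - b n)) ->
  x 0%N = y 0%N.
Proof.
move=> xS yS xb yb; apply/eqP; rewrite -subr_eq0; apply/eqP/pmultiple_eq0 => m.
(* The parity term balances the gain: an even step gains p^2 and an odd step nothing, yet each
   raises [m] by one. *)
suff h n : pmultiple (m + ~~ odd n) (x n - y n).
  exact: pmultiple_le (leq_addr _ _) (h 0%N).
elim: m n => [|m IH] n.
  have -> : x n - y n = (x n - b n) + - (y n - b n) by ring.
  exact: pmultipleD (xb n) (pmultipleN (yb n)).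
have -> : x n - y n = (x n - b n) * (y n - b n) * - (x n.+1 - y n.+1).
  transitivity ((y n.+1 * (y n - b n)) * (x n - b n) - x n.+1 * (x n - b n) * (y n - b n)).
    by rewrite xS yS; ring.
  ring.
have := pmultipleM (pmultipleM (xb n) (yb n)) (pmultipleN (IH n.+1)).
by apply: pmultiple_le => /=; case: (odd n) => /=; lia.
Qed.

End PadicIntegral.

(** * Errors of the convergents and their transfer between roots *)

Lemma cf_det (a : nat -> rat) n :
  cf_num a n.+1 * cf_den a n - cf_num a n * cf_den a n.+1 = (-1) ^+ n.
Proof.
elim: n => [|n IH]; first by rewrite /= expr0; ring.
rewrite exprS -IH; change (cf_num a n.+2) with (a n.+2 * cf_num a n.+1 + cf_num a n).
change (cf_den a n.+2) with (a n.+2 * cf_den a n.+1 + cf_den a n); ring.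
Qed.

(** Otherwise [f] and [g] would be coprime, also over [F], and share no root. With [dvdp_root] this
    replaces conjugation: a rational relation at one root of [f] holds at every root in any
    field. *)
Lemma dvdp_irreducible_root (F : fieldType) (phi : {rmorphism rat -> F})
    (f g : {poly rat}) (x : F) : irreducible_poly f ->
  root (map_poly phi f) x -> root (map_poly phi g) x -> f %| g.
Proof.
move=> irr fx gx; apply: contraT; rewrite -irreducible_poly_coprime //.
by rewrite -(coprimep_map phi) => /coprimep_root /(_ fx); rewrite (rootP gx) eqxx.
Qed.

Lemma dvdp_root (F : fieldType) (phi : {rmorphism rat -> F})
    (f g : {poly rat}) (x : F) : f %| g ->
  root (map_poly phi f) x -> root (map_poly phi g) x.
Proof. by rewrite -(dvdp_map phi) => /dvdpP[q ->]; rewrite rootM orbC => ->. Qed.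

(* The value at x is A_n - x B_n: polynomial identities with rational coefficients
   carry relations between errors from one root of f to another. *)
Definition cf_error_poly (a : nat -> rat) n : {poly rat} :=
  (cf_num a n)%:P - (cf_den a n) *: 'X.

Section Error.
Variables (F : fieldType) (phi : {rmorphism rat -> F}) (a : nat -> rat).

Definition cf_error (x : F) n := phi (cf_num a n) - x * phi (cf_den a n).

Lemma horner_error_poly x n : (map_poly phi (cf_error_poly a n)).[x] = cf_error x n.
Proof.
rewrite /cf_error_poly rmorphB /= map_polyC map_polyZ map_polyX !hornerE.
by rewrite /cf_error mulrC.
Qed.

Lemma cf_error_cross x y n :
  cf_error x n.+1 * cf_error y n - cf_error x n * cf_error y n.+1 =
    (x - y) * (-1) ^+ n.
Proof.
have := congr1 phi (cf_det a n); rewrite rmorphB !rmorphM rmorphXn rmorphN1 => <-.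
rewrite /cf_error; ring.
Qed.

(** The error polynomial has degree at most 1, so [f] divides it only if A_n = B_n = 0, against the
    determinant identity. *)
Lemma cf_error_neq0 (f : {poly rat}) x n : irreducible_poly f -> (2 < size f)%N ->
  root (map_poly phi f) x -> cf_error x n != 0.
Proof.
move=> irr f3 fx; apply/negP; rewrite -horner_error_poly => ex.
have fe := dvdp_irreducible_root irr fx ex.
have e0 : cf_error_poly a n = 0.
  apply/eqP/contraT => /dvdp_leq /(_ fe); rewrite leqNgt => /negP[].
  apply: leq_ltn_trans f3; rewrite (leq_trans (size_polyD _ _)) // geq_max.
  rewrite size_polyN (leq_trans (size_polyC_leq1 _)) //.
  by rewrite (leq_trans (size_scale_leq _ _)) // size_polyX.
have A0 : cf_num a n = 0.
  have := congr1 (fun q : {poly rat} => q`_0) e0.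
  by rewrite /cf_error_poly coefB coefC coefZ coefX coef0 mulr0 subr0.
have B0 : cf_den a n = 0.
  have := congr1 (fun q : {poly rat} => q`_1) e0.
  rewrite /cf_error_poly coefB coefC coefZ coefX coef0 mulr1 sub0r.
  by move/eqP; rewrite oppr_eq0 => /eqP.
have := cf_det a n; rewrite A0 B0 mulr0 mul0r subr0 => /esym/eqP.
by rewrite signr_eq0.
Qed.

Lemma cf_error_complete (x : nat -> F) n :
  (forall n, x n.+1 * (x n - phi (a n)) = 1) ->
  cf_error (x 0%N) n.+1 = - (x n.+1 - phi (a n.+1)) * cf_error (x 0%N) n.
Proof.
move=> xS; elim: n => [|n IH].
  have := xS 0%N; rewrite /cf_error /= rmorphD rmorphM rmorph1 mulr1 => <-; ring.
(* Multiplying the induction hypothesis by x_(n+2) inverts it; the three-term recurrence then yields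
   the next error. *)
have En : cf_error (x 0%N) n = - x n.+2 * cf_error (x 0%N) n.+1.
  by rewrite IH mulrA mulrNN xS mul1r.
transitivity (phi (a n.+2) * cf_error (x 0%N) n.+1 + cf_error (x 0%N) n).
  rewrite /cf_error.
  change (cf_num a n.+2) with (a n.+2 * cf_num a n.+1 + cf_num a n).
  change (cf_den a n.+2) with (a n.+2 * cf_den a n.+1 + cf_den a n).
  rewrite !rmorphD !rmorphM; ring.
by rewrite {1}En; ring.
Qed.

End Error.

(** * Periodicity of the p-adic errors *)

Lemma eventually_periodic_even (T : Type) (a : nat -> T) : eventually_periodic a ->
  exists N k, [/\ (0 < k)%N, ~~ odd N, ~~ odd k &
    forall n, (N <= n)%N -> a (n + k)%N = a n].
Proof.
(* An even period preserves index parity, hence both the divisibility pattern of the remainders and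
   the sign (-1)^n. *)
move=> [N [k [k0 ak]]]; exists N.*2, k.*2; split=> [|||n Nn].
- by rewrite double_gt0.
- by rewrite odd_double.
- by rewrite odd_double.
- by rewrite -addnn addnA !ak //; lia.
Qed.

Section PadicError.
Variables (p : nat) (p_pr : prime p).
Local Notation Qp := (padic p_pr).
Local Notation ratrp := (@padic_ratr p p_pr).

(** The periodicity is stated without division so that it is a polynomial relation between errors,
    which transfers to the real roots. Here [q] is the factor lambda. *)
Lemma padic_error_periodic alg (alpha : Qp) a : odd p ->
  is_padic_cf alg alpha a -> eventually_periodic a ->
  exists N k, [/\ (0 < k)%N, ~~ odd k,
    forall j, cf_error ratrp a alpha (N + j + k) * cf_error ratrp a alpha N =
      cf_error ratrp a alpha (N + k) * cf_error ratrp a alpha (N + j)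
    & exists2 q, pmultiple 1 q &
      cf_error ratrp a alpha (N + k) = q * cf_error ratrp a alpha N].
Proof.
move=> po acf /eventually_periodic_even[N [k [k0 oN ok ak]]].
have [x [<- xS xa]] := complete_quotients po acf.
have uS n := @cf_error_complete _ ratrp a x n xS.
set u := cf_error ratrp a (x 0%N) in uS *.
(* The tails from N and from N + k have the same partial quotients, so they start at the same
   complete quotient. *)
have xN : x N = x (N + k)%N.
  have := @complete_quotient_unique _ p_pr (fun n => x (N + n)%N)
    (fun n => x (N + k + n)%N) (fun n => ratrp (a (N + n)%N)).
  rewrite !addn0; apply=> n.
  - by rewrite addnS xS.
  - by rewrite addnS -(ak (N + n)%N) ?leq_addr // addnAC xS.
  - by have := xa (N + n)%N; rewrite oddD (negbTE oN).
  - rewrite -(ak (N + n)%N) ?leq_addr // (addnAC N n k).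
    by have := xa (N + k + n)%N; rewrite !oddD (negbTE oN) (negbTE ok).
have xk n : x (N + n + k)%N = x (N + n)%N.
  elim: n => [|n IH]; first by rewrite addn0.
  have ne : x (N + n)%N - ratrp (a (N + n)%N) != 0.
    apply/eqP => e; have := xS (N + n)%N; rewrite e mulr0 => /esym/eqP.
    by rewrite oner_eq0.
  apply: (mulIf ne); rewrite addnS xS addSn -IH -(ak (N + n)%N) ?leq_addr //.
exists N, k; split=> // [j|].
  elim: j => [|j IH]; first by rewrite addn0 mulrC.
  rewrite addnS addSn !uS -mulrA IH -addSn -addnS xk ak ?leq_addr //; ring.
(* The factor is a product over the indices N+1 to N+j; as N is even, the first even one is N+2,
   whence 1 < j. *)
have h j : exists2 q, pmultiple (1 < j)%N q & u (N + j)%N = q * u N.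
  elim: j => [|j [q qm qE]].
    by exists 1; rewrite ?addn0 ?mul1r //; exact: (pmultiple_int p_pr 1).
  exists (- (x (N + j).+1 - ratrp (a (N + j).+1)) * q); last first.
    by rewrite addnS uS qE mulrA.
  have := pmultipleM (pmultipleN (xa (N + j).+1)) qm.
  apply: pmultiple_le; rewrite /= oddD (negbTE oN) /= negbK.
  by case: j {qm qE} => [|[|j]] /=; lia.
have [q qm qE] := h k; exists q => //; apply: pmultiple_le qm.
by case: k k0 ok {ak xN xk qE} => [|[|k]].
Qed.

End PadicError.

(** * From geometric decay of error ratios to real convergence *)

Section RealLimit.
Variable R : realType.
Import numFieldNormedType.Exports.
Local Open Scope classical_set_scope.

Lemma cvg_geometric_step (r : nat -> R) (rho : R) N k : (0 < k)%N -> `|rho| < 1 ->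
  (forall j, r (N + j + k)%N = rho * r (N + j)%N) -> r @ \oo --> (0 : R).
Proof.
move=> k0 rho1 rS.
have rE q i : r (N + (q * k + i))%N = rho ^+ q * r (N + i)%N.
  elim: q => [|q IH]; first by rewrite mul1r.
  by rewrite exprS -mulrA -IH -rS; congr r; lia.
(* Each residue class modulo k is geometric; [C] bounds the starting values of all of them. *)
pose C := \sum_(i < k) `|r (N + i)%N|.
have rC i : (i < k)%N -> `|r (N + i)%N| <= C.
  by move=> ik; rewrite /C (bigD1 (Ordinal ik)) //= lerDl sumr_ge0.
have rhoc : `|(`|rho|)| < 1 by rewrite normr_id.
have /cvgrPdist_lt cv := @cvg_geometric R C `|rho| rhoc.
apply/cvgrPdist_lt => e e0; have [M _ hM] := cv e e0.
exists (N + M * k)%N => // n /= nM; rewrite sub0r normrN.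
have jE : n = (N + ((n - N) %/ k * k + (n - N) %% k))%N by rewrite -divn_eq; lia.
rewrite jE rE normrM normrX mulrC.
have MM : (M <= (n - N) %/ k)%N by rewrite leq_divRL //; lia.
have := hM _ MM; rewrite /= sub0r normrN; apply: le_lt_trans.
rewrite /geometric /= (le_trans _ (ler_norm _)) //.
by rewrite ler_wpM2r ?exprn_ge0 // rC // ltn_mod.
Qed.

Lemma real_cf_cvg_ratio (a : nat -> rat) (x y : R) :
  (forall n, cf_error ratr a x n != 0) ->
  (forall n, cf_error ratr a y n != 0) ->
  (fun n => cf_error ratr a x n / cf_error ratr a y n) @ \oo --> (0 : R) ->
  real_cf_cvg a x.
Proof.
move=> x0 y0; set r := (fun n => _) => r0.
(* Solving r = (A - xB) / (A - yB) for A/B gives this expression. *)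
have lim : (fun n => (x - r n * y) / (1 - r n)) @ \oo --> x.
  have -> : x = (x - 0 * y) / (1 - 0) by rewrite mul0r !subr0 divr1.
  apply: cvgM.
    by apply: cvgB; [rewrite mul0r !subr0 divr1; exact: cvg_cst|apply: cvgMl].
  by apply: cvgV; [rewrite subr0 oner_eq0|apply: cvgB => //; exact: cvg_cst].
rewrite /real_cf_cvg; apply: cvg_trans lim; apply: near_eq_cvg.
have /cvgrPdist_lt /(_ 1 ltr01) := r0; apply: filterS => n; rewrite sub0r normrN => rn.
have r1 : 1 - r n != 0 by rewrite subr_eq0; apply: contraTneq rn => <-; rewrite normr1 ltxx.
have E : cf_error ratr a x n = r n * cf_error ratr a y n by rewrite /r divfK.
(* If B_n were 0, both errors would equal A_n and the ratio would be 1. *)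
rewrite /cf_error /= in E; have B0 : (ratr (cf_den a n) : R) != 0.
  apply/eqP => B0; have := x0 n; rewrite /cf_error /= B0 !mulr0 !subr0 in E *.
  move=> A0; move: r1; rewrite subr_eq0 => /negP; apply; apply/eqP.
  by apply: (mulIf A0); rewrite mul1r.
rewrite /convergent fmorph_div; apply: (mulIf B0); rewrite [RHS]divfK //.
rewrite mulrAC; apply: (canLR (mulfK r1)).
have -> : ratr (cf_num a n) * (1 - r n) =
    (ratr (cf_num a n) - x * ratr (cf_den a n)) - r n * ratr (cf_num a n)
    + x * ratr (cf_den a n) by ring.
rewrite E; ring.
Qed.

End RealLimit.

(** * Comparison of the two real errors over a period *)

Theorem proposition1 (R : realType) (p : nat) (p_pr : prime p) (p_odd : odd p)
    (f : {poly rat}) (f_irr : irreducible_poly f) (f_deg : size f = 3%N)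
    (alpha_r alpha_r' : R)
    (f_alpha_r : root (map_poly ratr f) alpha_r)
    (f_alpha_r' : root (map_poly ratr f) alpha_r')
    (alpha_r_neq : alpha_r <> alpha_r')
    (alpha_p : padic p_pr) (f_alpha_p : root (map_poly ratr f) alpha_p)
    (alg : algorithm) (a : nat -> rat) (a_cf : is_padic_cf alg alpha_p a)
    (a_per : eventually_periodic a) :
  real_cf_cvg a alpha_r \/ real_cf_cvg a alpha_r'.
Proof.
have [N [k [k0 ok up [q q1 uq]]]] := padic_error_periodic p_odd a_cf a_per.
have f_alpha : root (map_poly (@padic_ratr p p_pr) f) alpha_p by [].
have f2 : (2 < size f)%N by rewrite f_deg.
pose g := cf_error_poly a.
pose e (x : R) n := cf_error ratr a x n.
have e_neq0 x n : root (map_poly ratr f) x -> e x n != 0.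
  exact: cf_error_neq0.
have e_per x : root (map_poly ratr f) x ->
    exists2 l, l != 1 /\ l != -1 & forall j, e x (N + j + k)%N = l * e x (N + j)%N.
  move=> fx; have eN := e_neq0 x N fx.
  exists (e x (N + k)%N / e x N); last first.
    move=> j; apply: (mulIf eN).
    rewrite mulrAC divfK //; apply/eqP; rewrite -subr_eq0.
    (* The periodicity relation passes from the p-adic root to the real root [x]. *)
    have /dvdp_root /(_ fx) : f %| g (N + j + k)%N * g N - g (N + k)%N * g (N + j)%N.
      apply: (dvdp_irreducible_root f_irr f_alpha); apply/rootP.
      by rewrite rmorphB !rmorphM /= hornerD hornerN !hornerM !horner_error_poly up subrr.
    by rewrite /root rmorphB !rmorphM /= hornerD hornerN !hornerM !horner_error_poly.
  (* Transfer in the other direction: a real factor 1 or -1 would force [q] to be that same unit,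
     while p divides [q]. *)
  have unit_neq (c : rat) : c = 1 \/ c = -1 -> e x (N + k)%N / e x N != ratr c.
    move=> c1; apply/eqP => ec.
    have /dvdp_root /(_ f_alpha) : f %| g (N + k)%N - c *: g N.
      apply: (dvdp_irreducible_root f_irr fx); apply/rootP.
      rewrite rmorphB /= map_polyZ hornerD hornerN hornerZ !horner_error_poly.
      by rewrite /= -ec divfK ?subrr //; exact: eN.
    rewrite /root rmorphB /= map_polyZ hornerD hornerN hornerZ !horner_error_poly uq.
    rewrite subr_eq0 => /eqP/mulIf-/(_ (cf_error_neq0 _ _ f_irr f2 f_alpha)) qc.
    apply: (pmultiple1 _ q1); rewrite qc.
    by case: c1 => ->; [left|right]; rewrite ?rmorphN rmorph1.
  split; first by have := unit_neq 1 (or_introl erefl); rewrite rmorph1.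
  by have := unit_neq (-1) (or_intror erefl); rewrite rmorphN rmorph1.
have [l [l1 lN1] el] := e_per _ f_alpha_r.
have [l' _ el'] := e_per _ f_alpha_r'.
(* As [k] is even, the cross difference of the errors is the same at N + k as at N, while a period
   multiplies it by l * l'. *)
have ll : l * l' = 1.
  have := cf_error_cross ratr a alpha_r alpha_r' (N + k).
  rewrite -signr_odd oddD (negbTE ok) addbF signr_odd.
  rewrite -(cf_error_cross ratr a alpha_r alpha_r' N) -addSn -!/(e _ _).
  have := el 0%N; have := el 1%N; have := el' 0%N; have := el' 1%N.
  rewrite !addn0 addn1 => -> -> -> -> E.
  have /mulIf : (alpha_r - alpha_r') * (-1) ^+ N != 0.
    by rewrite mulf_neq0 ?signr_eq0 // subr_eq0; apply/eqP.
  apply; rewrite mul1r -(cf_error_cross ratr a alpha_r alpha_r' N) -!/(e _ _) -{2}E.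
  ring.
have l0 : l != 0 by apply/eqP => l0; move/eqP: ll; rewrite l0 mul0r eq_sym oner_eq0.
have l'E : l' = l^-1 by apply: (mulfI l0); rewrite ll divff.
have l'0 : l' != 0 by rewrite l'E invr_eq0.
have cvg x y m m' : root (map_poly ratr f) x -> root (map_poly ratr f) y ->
    (forall j, e x (N + j + k)%N = m * e x (N + j)%N) ->
    (forall j, e y (N + j + k)%N = m' * e y (N + j)%N) ->
    `|m / m'| < 1 -> real_cf_cvg a x.
  move=> fx fy em em' mm; apply: (@real_cf_cvg_ratio _ _ x y) => [n|n|].
  - exact: e_neq0.
  - exact: e_neq0.
  apply: (cvg_geometric_step k0 mm (N := N)) => j.
  by rewrite -!/(e _ _) em em' invfM mulrACA.
(* The ratio of errors is multiplied by l^2 or by its inverse; |l| = 1 would mean that the real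
   number [l] is 1 or -1. *)
have [lt1|gt1|/eqP] := ltgtP `|l| 1.
- left; apply: cvg f_alpha_r f_alpha_r' el el' _.
  by rewrite l'E invrK normrM mulr_ilt1.
- right; apply: cvg f_alpha_r' f_alpha_r el' el _.
  by rewrite l'E -invfM normfV invf_lt1 ?normrM ?mulr_egt1 // mulr_gt0 // normr_gt0.
- by rewrite eqr_norml ler01 andbT (negbTE l1) (negbTE lN1).
Qed.
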